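(* There exists a family $\mathcal{F}\subset\mathbb{R}^{\mathbb{R}^2}$ of cardinality $2^{\mathfrak{c}}$ such that, for each $n\in\mathbb{N}$, each nonzero polynomial $h\colon\mathbb{R}^n\to\mathbb{R}$ without constant term and every sequence $\langle f_1,\ldots,f_n\rangle$ of distinct elements of $\mathcal{F}$, we have $h(f_1,\ldots,f_n)\in\mathrm{VFC}\setminus\mathrm{FC}$. Consequently, the family $\mathrm{VFC}\setminus\mathrm{FC}$ is strongly $2^{\mathfrak{c}}$-algebrable (as a subset of the commutative algebra $\mathbb{R}^{\mathbb{R}^2}$ of all functions from $\mathbb{R}^2$ to $\mathbb{R}$ with pointwise operations).
   Context: Notation: $x_n\searrow x$ means that $(x_n)$ is a strictly decreasing sequence of reals converging to $x$; $\mathfrak{c}$ is the cardinality of the continuum. Let $f\colon\mathbb{R}^2\to\mathbb{R}$. $f$ is feebly continuous at $\langle x,y\rangle$ if there exist $x_n\searrow x$ and $y_m\searrow y$ such that $\lim_{n\to\infty}\lim_{m\to\infty}f(x_n,y_m)=f(x,y)$. $f$ is very feebly continuous at $\langle x,y\rangle$ if there exist $x_n\searrow x$ and, for each $n\in\mathbb{N}$, a sequence $y^{(n)}_m\searrow y$ (as $m\to\infty$) such that $\lim_{n\to\infty}\lim_{m\to\infty}f(x_n,y^{(n)}_m)=f(x,y)$. (In both cases the inner limits exist in $\mathbb{R}$ for each $n$, and the outer limit exists.) $\mathrm{FC}$ and $\mathrm{VFC}$ denote the sets of all functions $f\colon\mathbb{R}^2\to\mathbb{R}$ that are feebly continuous,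 respectively very feebly continuous, at every point of $\mathbb{R}^2$. Here $h(f_1,\ldots,f_n)$ is the function $z\mapsto h(f_1(z),\ldots,f_n(z))$. Let $L$ be a commutative linear algebra and $\kappa$ a cardinal. A set $A\subset L$ is strongly $\kappa$-algebrable if $A\cup\{0\}$ contains a $\kappa$-generated algebra that is isomorphic to a free algebra. Equivalently, there is a set $X\subset L$ of cardinality $\kappa$ (a set of free generators) such that for any $k\in\mathbb{N}$, any nonzero real polynomial $P$ in $k$ variables without constant term, and any distinct $y_1,\dots,y_k\in X$, we have $P(y_1,\dots,y_k)\neq 0$ and $P(y_1,\dots,y_k)\in A$. *)

(* Defs.v *)
From HB Require Import structures.
From mathcomp Require Import all_boot all_order all_algebra.
From mathcomp Require Import all_classical all_reals all_analysis.
(* The notations of multinomials clash with those of MathComp-Analysis; both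
   libraries below also define [mcoeff], which is therefore always qualified. *)
From mathcomp Require Import -(notations) mpoly monalg.

Set Implicit Arguments.
Unset Strict Implicit.
Unset Printing Implicit Defensive.

Import Order.TTheory GRing.Theory Num.Theory.
Import numFieldNormedType.Exports.

Local Open Scope classical_set_scope.
Local Open Scope card_scope.
Local Open Scope ring_scope.

(* MathComp-Analysis makes [T -> R] a commutative ring and an R-module for the
   pointwise operations; the two instances below make it a commutative algebra. *)
Lemma fct_scalerAl (T : Type) (R : realType) (a : R) (f g : T -> R) :
  a *: (f * g) = (a *: f) * g.
Proof. by apply/funext => x; rewrite [LHS]mulrA. Qed.

HB.instance Definition _ (T : pointedType) (R : realType) :=
  GRing.Lmodule_isLalgebra.Build R (T -> R) (@fct_scalerAl T R).
HB.instance Definition _ (T : pointedType) (R : realType) :=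
  GRing.Lalgebra_isComAlgebra.Build R (T -> R).

Section FeebleContinuity.
Variable R : realType.
Implicit Types (f : R * R -> R) (z : R * R).

Definition decreases_to (u : nat -> R) (x : R) : Prop :=
  decreasing_seq u /\ u @ \oo --> x.

(* Every inner limit lim_m a n m is required to exist in R. *)
Definition iterated_limit (a : nat -> nat -> R) (l : R) : Prop :=
  exists g : nat -> R, (forall n, a n @ \oo --> g n) /\ g @ \oo --> l.

Definition feebly_continuous_at f z : Prop :=
  exists x y : nat -> R,
    [/\ decreases_to x z.1, decreases_to y z.2 &
        iterated_limit (fun n m => f (x n, y m)) (f z)].

Definition very_feebly_continuous_at f z : Prop :=
  exists (x : nat -> R) (y : nat -> nat -> R),
    [/\ decreases_to x z.1, forall n, decreases_to (y n) z.2 &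
        iterated_limit (fun n m => f (x n, y n m)) (f z)].

Definition FC : set (R * R -> R) :=
  [set f | forall z, feebly_continuous_at f z].

Definition VFC : set (R * R -> R) :=
  [set f | forall z, very_feebly_continuous_at f z].

End FeebleContinuity.

Arguments FC : clear implicits.
Arguments VFC : clear implicits.

Section StrongAlgebrability.
Variable R : comNzRingType.

(* Algebras here need not have a unit. [malg (cmonom I) R] is the polynomial
   ring R[X_i, i in I], so the free commutative algebra generated by I is its
   ideal of polynomials without constant term ([onecm I] being the trivial
   monomial). *)
Definition free_algebra (I : choiceType) : set (malg (cmonom I) R) :=
  [set p | monalg.mcoeff (onecm I) p = 0].

Variable L : comAlgType R.

Definition is_subalgebra (B : set L) : Prop :=
  [/\ B 0,
      forall u v, B u -> B v -> B (u + v),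
      forall u v, B u -> B v -> B (u * v) &
      forall (a : R) u, B u -> B (a *: u)].

Definition algebra_iso (I : choiceType) (B : set L)
    (phi : malg (cmonom I) R -> L) : Prop :=
  [/\ set_bij (@free_algebra I) B phi,
      forall p q, free_algebra p -> free_algebra q -> phi (p + q) = phi p + phi q,
      forall p q, free_algebra p -> free_algebra q -> phi (p * q) = phi p * phi q &
      forall (a : R) p, free_algebra p -> phi (a *: p) = a *: phi p].

(* The cardinal kappa is given by a set K of that cardinality. The algebra B is
   kappa-generated by the images of the variables. *)
Definition strongly_algebrable (U : Type) (K : set U) (A : set L) : Prop :=
  exists (I : choiceType) (B : set L) (phi : malg (cmonom I) R -> L),
    [/\ [set: I] #= K, is_subalgebra B, B `<=` A `|` [set 0] &
        algebra_iso B phi].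

End StrongAlgebrability.

(* Main.v *)
From HB Require Import structures.
Require Import Defs.
From mathcomp Require Import finmap.
From mathcomp Require Import all_boot all_order all_algebra.
From mathcomp Require Import all_classical all_reals all_analysis.
From mathcomp Require Import -(notations) mpoly monalg.
From mathcomp Require Import ring lra zify.

Import Order.TTheory GRing.Theory Num.Theory numFieldNormedType.Exports.
Local Open Scope classical_set_scope.
Local Open Scope card_scope.
Local Open Scope ring_scope.

Set Implicit Arguments.
Unset Strict Implicit.
Unset Printing Implicit Defensive.

(** The functions are supported on a set that meets every horizontal line in
    one point. Each real [y] carries a rational [q(y)], and the function
    attached to an index set [A] takes at [(q(y), y)] a natural number
    [F_A(y)] and vanishes at every other point of the line of height [y].

    The values [F_A] form an independent family: for finitely many distinct
    [A], prescribed natural values and a prescribed rational [q], the heights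
    [y] with [q(y) = q] that realise the values are dense
    ([vfc_function_independent]). This is the Fichtenholz-Kantorovich-Hausdorff
    argument with [2^c] index sets [A], the subsets of [R]: finitely many
    subsets are told apart by their traces on a finite set [D] of reals, and
    the pair consisting of [D] and a finite table from traces to numbers is a
    datum that can be stored in a single real. To get density, it is stored
    in the asymptotic behaviour of the ternary digits of [y], which can be
    prescribed inside any interval ([dense_decode]).

    Let [g] be any function [G] of finitely many members of the family, with
    [G(0) = 0] and [G] nonzero at some vector of naturals. At a point [(a, b)]
    choose rationals [x_n] decreasing to [a]; for each [n], independence gives
    heights decreasing to [b] on which [g(x_n, -)] is constantly [g(a, b)].
    Hence [g] is very feebly continuous. On the other hand [g] is nonzero
    somewhere, and feeble continuity at such a point would give [y_m] such
    that [g(x_n, y_m)] is nonzero, for all large [m], for two different [x_n];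
    both would equal [q(y_m)], which is absurd. This is [finitary_vfc_not_fc].

    Polynomials enter only through the fact that a nonzero one does not vanish
    at every vector of naturals ([nat_nonvanishing]). The same fact makes
    evaluation at the family injective on polynomials without constant term,
    which gives the free algebra. *)

(** * Ternary expansions *)

Section TernaryDigits.
Variable R : realType.
Implicit Types (x y a b : R) (s : nat -> bool).

(** The integer whose ternary digits, most significant first, are
    [s 0, ..., s n.-1]. *)
Fixpoint ternary_int s n : nat :=
  if n is m.+1 then (3 * ternary_int s m + s m)%N else 0%N.

(** The real [sum_i s i / 3 ^ i.+1], as the common point of nested intervals.
    Only the digits 0 and 1 are used, so the tail after [n] digits is at most
    [1/2] and the expansion is recovered by taking integer parts: no ambiguity
    between expansions can occur. *)
Lemma ternary_point s : exists y : R,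
  forall n, (ternary_int s n)%:R <= 3 ^+ n * y <= (ternary_int s n)%:R + 2^-1.
Proof.
pose lo n : R := (ternary_int s n)%:R / 3 ^+ n.
pose hi n : R := ((ternary_int s n)%:R + 2^-1) / 3 ^+ n.
have p3 n : (0 : R) < 3 ^+ n by rewrite exprn_gt0.
have loS n : lo n <= lo n.+1.
  rewrite /lo ler_pdivlMr // mulrAC ler_pdivrMr // exprS mulrA.
  rewrite ler_pM2r //= natrD natrM; case: (s n); rewrite ?mulr1n ?mulr0n; lra.
have hiS n : hi n.+1 <= hi n.
  rewrite /hi ler_pdivlMr // mulrAC ler_pdivrMr // exprS mulrA.
  rewrite ler_pM2r //= natrD natrM; case: (s n); rewrite ?mulr1n ?mulr0n; lra.
have lo_mono : {homo lo : n m / (n <= m)%N >-> n <= m}.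
  by apply: homo_leq => // ? ? ?; apply: le_trans.
have hi_mono : {homo hi : n m / (n <= m)%N >-> m <= n}.
  by apply: (@homo_leq _ hi (fun u v => v <= u)) => // ? ? ? h /le_trans; apply.
have lohi n m : lo n <= hi m.
  apply: (le_trans (lo_mono _ _ (leq_maxl n m))).
  apply: le_trans (hi_mono _ _ (leq_maxr n m)).
  by rewrite /lo /hi ler_pM2r ?invr_gt0 // lerDl invr_ge0.
have ne : range lo !=set0 by exists (lo 0%N), 0%N.
have hs : has_sup (range lo).
  by split=> //; exists (hi 0%N) => _ [n _ <-].
exists (sup (range lo)) => n; apply/andP; split.
  rewrite mulrC -ler_pdivrMr //; apply: ub_le_sup; first exact: hs.2.
  by exists n.
rewrite mulrC -ler_pdivlMr //; apply: ge_sup => // _ [m _ <-].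
exact: lohi.
Qed.

Definition ternary_digit y n : bool :=
  Num.floor (3 ^+ n.+1 * y) - 3 * Num.floor (3 ^+ n * y) == 1.

(** Adding a multiple of [3 ^- N] to a point does not change its digits from
    position [N] on, and these multiples are dense. *)
Lemma dense_eventual_digits s a b : a < b ->
  exists2 y, a < y < b &
    exists N, forall n, (N <= n)%N -> ternary_digit y n = s n.
Proof.
move=> ab.
have p3 n : (0 : R) < 3 ^+ n by rewrite exprn_gt0.
have [N hN] : exists N, 2 / (b - a) < 3 ^+ N :> R.
  exists (Num.bound (2 / (b - a) : R)).
  apply: (lt_le_trans (archi_boundP _)).
    by rewrite divr_ge0 // subr_ge0 ltW.
  by rewrite -natrX ler_nat ltnW // ltn_expl.
have {}hN : 2 < 3 ^+ N * (b - a) by rewrite -ltr_pdivrMr // subr_gt0.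
have [z hz] := ternary_point (fun n => s (N + n)%N).
set t := ternary_int _ in hz.
pose m := Num.floor (3 ^+ N * a) + 1.
have m_gt : 3 ^+ N * a < m%:~R by exact: floorD1_gt.
have m_le : m%:~R <= 3 ^+ N * a + 1.
  by rewrite /m intrD lerD2r floor_le.
clearbody m.
have z0 : 0 <= z <= 2^-1.
  by have := hz 0%N; rewrite /= expr0 mul1r add0r.
exists ((m%:~R + z) / 3 ^+ N).
  rewrite ltr_pdivlMr // ltr_pdivrMr //.
  move: hN; rewrite mulrBr ![_ * 3 ^+ N]mulrC => hN; lra.
have fl n : Num.floor (3 ^+ (N + n) * ((m%:~R + z) / 3 ^+ N) : R)
    = 3 ^+ n * m + (t n)%:Z.
  apply: floor_def.
  have -> : 3 ^+ (N + n) * ((m%:~R + z) / 3 ^+ N)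
      = 3 ^+ n * m%:~R + 3 ^+ n * z :> R.
    by rewrite exprD; field; rewrite gt_eqF.
  have := hz n; rewrite !intrD intrM rmorphXn /= -!pmulrn => ?; lra.
exists N => n Nn; have en := fl (n - N)%N; have eS := fl (n - N).+1.
rewrite addnS subnKC // in en eS.
rewrite /ternary_digit eS en exprS -mulrA /t /= subnKC //.
by move: (3 ^+ (n - N) * m) (ternary_int _ _) (s n) => u v []; lia.
Qed.

End TernaryDigits.

(** * Storing countable data densely in the reals *)

Section DenseCoding.
Variable R : realType.
Implicit Types (y a b : R).

(** The positions [n] are split into the infinite columns [logn 2 n = k], and
    bit [k] is read off from the digits far down column [k]; it is insensitive
    to finitely many digits. *)
Definition tail_bits y : nat -> bool := fun k =>
  `[< exists N, forall n, (N <= n)%N -> logn 2 n = k -> ternary_digit y n >].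

Lemma tail_bitsE (s : nat -> bool) y :
  (exists N, forall n, (N <= n)%N -> ternary_digit y n = s (logn 2 n)) ->
  tail_bits y = s.
Proof.
move=> [N hN]; apply/funext => k; apply/asboolP/idP => [[N' hN']|sk]; last first.
  by exists N => n Nn nk; rewrite hN // nk.
(* a position of column k beyond both bounds *)
pose n := (2 ^ k * (2 * (N + N')).+1)%N.
have nk : logn 2 n = k.
  by rewrite lognM ?expn_gt0 // pfactorK // lognE /= dvdn2 /= oddM addn0.
have Nn : (N + N' <= n)%N.
  have : (0 < 2 ^ k)%N by rewrite expn_gt0.
  by rewrite /n; nia.
rewrite -[in s _]nk -hN; first apply: hN' => //.
  exact: leq_trans (leq_addl _ _) Nn.
exact: leq_trans (leq_addr _ _) Nn.
Qed.

Lemma dense_tail_bits (s : nat -> bool) a b : a < b ->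
  exists2 y, a < y < b & tail_bits y = s.
Proof.
move=> /(dense_eventual_digits (fun n => s (logn 2 n)))[y yab hy].
by exists y => //; exact: tail_bitsE.
Qed.

Variable C : countType.

(** A real is recorded by its lower cut in [rat], so that a sequence of reals
    together with an element of a countable type becomes a sequence of bits. *)
Definition code_bits (t : C * (nat -> R)) : nat -> bool := fun n =>
  match (unpickle n : option (C + nat * rat)) with
  | Some (inl c) => c == t.1
  | Some (inr (i, q)) => ratr q < t.2 i
  | None => false
  end.

Lemma code_bits_inj : injective code_bits.
Proof.
move=> [c r] [c' r'] e; congr pair.
  have := congr1 (fun g => g (pickle (inl c : C + nat * rat))) e.
  by rewrite /code_bits pickleK /= eqxx => /esym/eqP.
apply/funext => i.
have cut q : (ratr q < r i) = (ratr q < r' i).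
  have := congr1 (fun g => g (pickle (inr (i, q) : C + nat * rat))) e.
  by rewrite /code_bits pickleK.
apply/eqP; rewrite eq_le; apply/andP; split; rewrite leNgt; apply/negP.
  move=> /rat_in_itvoo[q]; rewrite in_itv /= => /andP[q1 q2].
  by move: q2; rewrite cut ltNge (ltW q1).
move=> /rat_in_itvoo[q]; rewrite in_itv /= => /andP[q1 q2].
by move: q2; rewrite -cut ltNge (ltW q1).
Qed.

Definition decode (c0 : C) y : C * (nat -> R) :=
  xget (c0, fun=> 0) [set t | code_bits t = tail_bits y].

Lemma dense_decode c0 t a b : a < b ->
  exists2 y, a < y < b & decode c0 y = t.
Proof.
move=> /(dense_tail_bits (code_bits t))[y yab hy]; exists y => //.
apply: code_bits_inj; rewrite -hy.
by apply: (@xgetPex _ _ [set t | code_bits t = tail_bits y]); exists t.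
Qed.

End DenseCoding.

(** * The independent family *)

Section IndependentFamily.
Variable R : realType.
Implicit Types (x y a b : R) (A : set R).

Lemma dense_decreases_to (P : set R) (x : R) :
  (forall a b, a < b -> exists2 y, a < y < b & P y) ->
  exists2 u, decreases_to u x & forall n, P (u n).
Proof.
move=> dP.
pose choice_in (b : R) : R := xget 0 [set y | x < y < b /\ P y].
have cP b : x < b -> x < choice_in b < b /\ P (choice_in b).
  move=> /dP[y yb Py].
  by apply: (@xgetPex _ _ [set y | x < y < b /\ P y]); exists y.
pose u := fix u n := if n is m.+1 then choice_in (Num.min (u m) (x + n%:R^-1))
                     else choice_in (x + 1).
have xu n : x < u n.
  elim: n => [|n IH] /=.
    by have [|/andP[]] := cP (x + 1); rewrite ?ltrDl ?ltr01.
  by have [|/andP[]] := cP (Num.min (u n) (x + n.+1%:R^-1));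
    rewrite // lt_min IH ltrDl invr_gt0 ltr0n.
have uS n : [/\ u n.+1 < u n, u n.+1 < x + harmonic n & P (u n.+1)].
  have [|/andP[_]] := cP (Num.min (u n) (x + n.+1%:R^-1)).
    by rewrite lt_min xu ltrDl invr_gt0 ltr0n.
  by rewrite lt_min => /andP[].
exists u; last first.
  case=> [|n]; last by case: (uS n).
  by have [|] := cP (x + 1); rewrite ?ltrDl ?ltr01.
split; first by apply/decreasing_seqP => n; case: (uS n).
rewrite -cvg_shiftS.
apply: (@squeeze_cvgr _ _ _ _ (cst x) (fun n => x + harmonic n)).
- by apply: nearW => n; have [_ /ltW un _] := uS n; rewrite un andbT ltW // xu.
- exact: cvg_cst.
- rewrite -[X in _ --> X]addr0.
  by apply: cvgD; [exact: cvg_cst|exact: cvg_harmonic].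
Qed.

(** In [(q, (m, (keys, vals)))], [m] is the number of reals of the accompanying
    sequence that serve as test points, and [keys], [vals] are the two columns
    of a table sending a trace on the test points to a natural number. *)
Definition table : countType :=
  (rat * (nat * (seq (seq bool) * seq nat)))%type.

Definition default_table : table := (0, (0%N, ([::], [::]))).

Definition selected_rat y : rat := (decode default_table y).1.1.

Definition independent_value A y : nat :=
  let: ((_, (m, (keys, vals))), r) :=
    decode default_table y in
  nth 0 vals (index [seq `[<A p>] | p <- mkseq r m] keys).

Definition vfc_function A (z : R * R) : nat :=
  if z.1 == ratr (selected_rat z.2) then independent_value A z.2 else 0.

(** Take one point of the symmetric difference for each pair of sets. *)
Lemma separating_points (s : seq (set R)) : exists D : seq R,
  {in s &, injective (fun A => [seq `[<A p>] | p <- D])}.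
Proof.
pose sep A B : R := xget 0 [set p | A p <> B p].
exists [seq sep A B | A <- s, B <- s] => A B sS sS' e.
apply: contrapT => neq.
have [p hp] : exists p, A p <> B p.
  apply: contrapT => H; apply/neq/funext => p.
  by apply: contrapT => ?; apply: H; exists p.
have hsep : A (sep A B) <> B (sep A B).
  by apply: (@xgetPex _ _ [set p | A p <> B p]); exists p.
have sepD : sep A B \in [seq sep A B | A <- s, B <- s].
  by apply/allpairsP; exists (A, B).
move: e => /eq_in_map /(_ _ sepD) AB.
exact: hsep (propext (asbool_eq_equiv AB)).
Qed.

(** Store in [y] the points that separate the sets of [s] and the table that
    maps the trace of each such [A] to [v A]. *)
Lemma vfc_function_independent (s : seq (set R)) (v : set R -> nat)
    (q : rat) a b :
  a < b -> exists2 y, a < y < b &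
    selected_rat y = q /\ {in s, forall A, independent_value A y = v A}.
Proof.
have [D injD] := separating_points s; pose tr A := [seq `[<A p>] | p <- D].
pose c : table := (q, (size D, ([seq tr A | A <- s], [seq v A | A <- s]))).
move=> /(dense_decode default_table (c, nth 0 D))[y yab dy].
exists y => //; rewrite /selected_rat /independent_value dy /c; split=> // A sA.
rewrite mkseq_nth -/(tr A) (nth_map A); first by rewrite nth_index_map.
by rewrite -(size_map tr) index_mem map_f.
Qed.

(** The value of [g] at any point is the value of [G] at a vector of naturals,
    hence is taken exactly on dense sets of every vertical line with rational
    abscissa; and two such lines share no height where [g] is nonzero. *)
Lemma finitary_vfc_not_fc (G : (set R -> R) -> R) (s : seq (set R))
    (v : set R -> nat) :
  (forall w w', {in s, w =1 w'} -> G w = G w') ->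
  G (fun=> 0) = 0 -> G (fun A => (v A)%:R) != 0 ->
  let g z := G (fun A => (vfc_function A z)%:R) in
  (VFC R `\` FC R) g /\ exists z, g z != 0.
Proof.
move=> Gs G0 Gv g.
have g_off x y : x != ratr (selected_rat y) -> g (x, y) = 0.
  move=> xy; rewrite /g -[RHS]G0; apply: Gs => A _.
  by rewrite /vfc_function /= (negbTE xy).
have g_on q (w : set R -> nat) a b : a < b -> exists2 y, a < y < b &
    g (ratr q, y) = G (fun A => (w A)%:R).
  move=> /(vfc_function_independent s w q)[y yab [qy wy]]; exists y => //.
  by apply: Gs => A sA; rewrite /vfc_function /= qy eqxx wy.
have ratP a b : a < b -> exists2 y, a < y < b & exists q : rat, y = ratr q.
  move=> /rat_in_itvoo[q]; rewrite in_itv /= => qab.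
  by exists (ratr q) => //; exists q.
have [y0 _ gy0] := g_on 0 v _ _ ltr01.
have gz : g (ratr 0, y0) != 0 by rewrite gy0.
split; last by exists (ratr 0, y0).
split.
  move=> [a b]; have [x xa xP] := dense_decreases_to a ratP.
  pose good n (u : nat -> R) :=
    decreases_to u b /\ forall m, g (x n, u m) = g (a, b).
  have /boolp.choice[y yP] : forall n, exists u, good n u.
    move=> n; rewrite /good; have [q ->] := xP n.
    have [u ub uP] :=
      dense_decreases_to b (g_on q (fun A => vfc_function A (a, b))).
    by exists u.
  exists x, y; split=> //=; first by move=> n; case: (yP n).
  exists (fun=> g (a, b)); split; last exact: cvg_cst.
  move=> n; under eq_fun do rewrite (yP n).2; exact: cvg_cst.
move=> /(_ (ratr 0, y0))[x [y [[x_decr _] _ [l [gl lg]]]]].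
have [N _ lN] := cvgr_neq0 _ lg gz.
(* where g does not vanish, the height determines the abscissa *)
have on n : (N <= n)%N -> \forall m \near \oo, x n = ratr (selected_rat (y m)).
  move=> /lN ln; apply: filterS (cvgr_neq0 _ (gl n) ln) => m.
  by apply: contra_neq_eq => /g_off.
have [m [eN eN1]] := filter_ex (filterI (on _ (leqnn N)) (on _ (leqnSn N))).
by have /(_ N) := (decreasing_seqP x).2 x_decr; rewrite eN eN1 ltxx.
Qed.

Lemma vfc_function_inj : injective (fun A z => (vfc_function A z)%:R : R).
Proof.
move=> A B AB; apply: contrapT => /eqP nAB.
have [y _ [qy yE]] := vfc_function_independent [:: A; B]
  (fun C => (C == A) : nat) 0 ltr01.
have := congr1 (fun f => f (ratr 0, y)) AB.
rewrite /vfc_function /= qy eqxx !yE ?inE ?eqxx ?orbT // eq_sym (negbTE nAB).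
by move/eqP; rewrite oner_eq0.
Qed.
End IndependentFamily.

(** * Polynomials do not vanish at all vectors of naturals *)

Section PolynomialNonvanishing.
Variable M : eqType.
Implicit Type E : seq M.

(** Kronecker substitution: weighting a new variable by a number larger than
    all weighted degrees so far makes the weighted degree determine the new
    exponent, as a quotient, and the old weighted degree, as a remainder. *)
Lemma separating_weights (X : eqType) (e : M -> X -> nat) E (s : seq X) :
  uniq s -> exists w : X -> nat, {in E &, forall m m',
    (\sum_(x <- s) w x * e m x = \sum_(x <- s) w x * e m' x)%N ->
    {in s, e m =1 e m'}}.
Proof.
elim: s => [|x s IHs] /=; first by exists (fun=> 0%N).
move=> /andP[xs /IHs[w hw]].
pose W m := (\sum_(y <- s) w y * e m y)%N.
pose B := (\max_(m <- E) W m).+1.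
have WB m : m \in E -> (W m < B)%N by move=> mE; rewrite ltnS leq_bigmax_seq.
exists (fun y => if y == x then B else w y) => m m' mE m'E.
have step n : (\sum_(y <- x :: s) (if y == x then B else w y) * e n y =
    e n x * B + W n)%N.
  rewrite big_cons eqxx mulnC; congr addn; apply: eq_big_seq => y ys.
  by case: eqP ys xs => // -> ->.
rewrite !step => eW.
have ex : e m x = e m' x.
  have := congr1 (fun n => n %/ B)%N eW.
  by rewrite /= !divnMDl // !divn_small ?WB // !addn0.
move: eW; rewrite ex => /addnI /(hw _ _ mE m'E) es y.
by rewrite inE => /predU1P[->|/es].
Qed.

Lemma nat_nonroot (F : numDomainType) (p : {poly F}) :
  p != 0 -> exists t : nat, p.[t%:R] != 0.
Proof.
move=> p0; apply: contrapT => noroot.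
have := @max_poly_roots _ p [seq t%:R | t <- iota 0 (size p)] p0.
rewrite size_map size_iota ltnn => H; apply: notF; apply: H; last first.
  by rewrite map_inj_uniq ?iota_uniq //; apply: mulrIn; exact: oner_neq0.
apply/allP => _ /mapP[t _ ->]; rewrite /root.
by apply: contrapT => /negP pt; apply: noroot; exists t.
Qed.

(** With separating weights [w], substituting ['X ^ w x] for the variable [x]
    turns the polynomial into a univariate one in which no two monomials
    merge. Monomials are abstract here, since both the polynomials in [n]
    variables and those in arbitrarily many variables are covered. *)
Lemma nat_nonvanishing (F : numDomainType) (X : eqType) (e : M -> X -> nat)
    (c : M -> F) E (s : seq X) (m0 : M) :
  uniq s -> uniq E -> m0 \in E -> c m0 != 0 ->
  {in E &, forall m m', {in s, e m =1 e m'} -> m = m'} ->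
  exists v : X -> nat,
    \sum_(m <- E) c m * \prod_(x <- s) (v x)%:R ^+ e m x != 0.
Proof.
move=> us uE m0E cm0 einj; have [w hw] := separating_weights e E us.
pose W m := (\sum_(x <- s) w x * e m x)%N.
pose p : {poly F} := \sum_(m <- E) c m *: 'X^(W m).
have p0 : p != 0.
  apply: contraNneq cm0 => p0.
  have := congr1 (fun q : {poly F} => q`_(W m0)) p0.
  rewrite coef0 coef_sum (bigD1_seq m0) //= coefZ coefXn eqxx mulr1.
  rewrite big_seq_cond big1 ?addr0 => [->//|m /andP[mE mm0]].
  rewrite coefZ coefXn; case: eqP => [eW|]; last by rewrite mulr0.
  by move: mm0; rewrite (einj m m0) ?eqxx //; apply: hw.
have [t pt] := nat_nonroot p0; exists (fun x => t ^ w x)%N.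
move: pt; rewrite horner_sum; congr (_ != 0); apply: eq_bigr => m _.
rewrite hornerZ hornerXn; congr (_ * _).
by rewrite -prodrXr; apply: eq_bigr => x _; rewrite natrX exprM.
Qed.

End PolynomialNonvanishing.

Lemma mpoly_nat_nonvanishing (F : numDomainType) (n : nat)
    (h : mpoly.mpoly n F) :
  h != 0 -> exists v : 'I_n -> nat, mpoly.meval (fun i => (v i)%:R) h != 0.
Proof.
move=> h0.
have [m0 m0h] : exists m, m \in mpoly.msupp h.
  case E: (mpoly.msupp h) => [|m E']; last by exists m; rewrite mem_head.
  by move/eqP: E; rewrite mpoly.msupp_eq0 (negbTE h0).
have [|||||v hv] := @nat_nonvanishing _ F 'I_n
   (fun (m : mpoly.multinom n) i => m i)
   (fun m => mpoly.mcoeff m h) (mpoly.msupp h) (index_enum 'I_n) m0.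
- exact: index_enum_uniq.
- exact: mpoly.msupp_uniq.
- by [].
- by rewrite -mpoly.mcoeff_msupp.
- by move=> m m' _ _ e; apply/mpoly.mnmP => i; apply: e; rewrite mem_index_enum.
by exists v; rewrite mpoly.mevalE.
Qed.

Lemma meval_zero (F : comNzRingType) (n : nat) (h : mpoly.mpoly n F) :
  mpoly.mcoeff mpoly.mnm0 h = 0 -> mpoly.meval (fun=> 0) h = 0.
Proof.
move=> h0; rewrite mpoly.mevalE big1 // => m _.
have [->|m0] := eqVneq m mpoly.mnm0; first by rewrite h0 mul0r.
have [i mi] : exists i, m i != 0%N.
  apply: contrapT => H; case/eqP: m0; apply/mpoly.mnmP => i.
  by rewrite mpoly.mnm0E; apply: contrapT => /eqP mi; apply: H; exists i.
by rewrite (bigD1 i) //= expr0n (negbTE mi) mul0r mulr0.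
Qed.

(** * Evaluation of polynomials in arbitrarily many variables *)

Section FreePolynomials.
Variables (R : realType) (I : choiceType).
Implicit Types (w : I -> R) (p q : malg (cmonom I) R) (m : cmonom I).

Definition monomial_eval w m : R := \prod_(i <- finsupp m) w i ^+ m i.

Lemma monomial_eval_widen w m (d : {fset I}) :
  (finsupp m `<=` d)%fset ->
  monomial_eval w m = \prod_(i <- d) w i ^+ m i.
Proof.
move=> md; rewrite /monomial_eval; apply: big_fset_incl => // i id.
by rewrite -cmE_eq0 => /eqP ->; rewrite expr0.
Qed.

Lemma monomial_evalM w : mmorphism (monomial_eval w).
Proof.
split=> [m m'|]; last first.
  by rewrite /monomial_eval mdom1 big_nil.
have md : (finsupp m `<=` finsupp (mmul m m'))%fset.
  by rewrite mdomD fsubsetUl.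
have md' : (finsupp m' `<=` finsupp (mmul m m'))%fset.
  by rewrite mdomD fsubsetUr.
rewrite (monomial_eval_widen _ md) (monomial_eval_widen _ md') -big_split /=.
by apply: eq_bigr => i _; rewrite cmM exprD.
Qed.

HB.instance Definition _ w :=
  monalg.isMultiplicative.Build (cmonom I) R (monomial_eval w)
    (monomial_evalM w).

Definition poly_eval w p : R := monalg.mmap idfun (monomial_eval w) p.

Lemma poly_evalD w p q : poly_eval w (p + q) = poly_eval w p + poly_eval w q.
Proof. exact: monalg.mmapD. Qed.

Lemma poly_evalM w p q : poly_eval w (p * q) = poly_eval w p * poly_eval w q.
Proof. exact: rmorphM. Qed.

Lemma poly_evalZ w a p : poly_eval w (a *: p) = a * poly_eval w p.
Proof. exact: monalg.mmapZ. Qed.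

Definition variables p : {fset I} :=
  (\bigcup_(m <- monalg.msupp p) finsupp (m : cmonom I))%fset.

Lemma finsupp_variables p m : m \in monalg.msupp p ->
  (finsupp m `<=` variables p)%fset.
Proof. by move=> mp; exact: bigfcup_sup. Qed.

Lemma poly_evalE w p : poly_eval w p =
  \sum_(m <- monalg.msupp p)
    monalg.mcoeff m p * \prod_(i <- variables p) w i ^+ m i.
Proof.
apply: eq_big_seq => m mp; congr (_ * _).
exact/monomial_eval_widen/finsupp_variables.
Qed.

Lemma poly_eval_local w w' p : {in variables p, w =1 w'} ->
  poly_eval w p = poly_eval w' p.
Proof.
move=> ww'; rewrite !poly_evalE; apply: eq_bigr => m _; congr (_ * _).
by apply: eq_big_seq => i ip; rewrite ww'.
Qed.

Lemma poly_eval0 p : @free_algebra R I p -> poly_eval (fun=> 0) p = 0.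
Proof.
move=> p0; rewrite /poly_eval monalg.mmapE big1 // => m _.
have [->|m0] := eqVneq m (onecm I); first by rewrite p0 mul0r.
have [i mi] : exists i, m i != 0%N.
  apply: contrapT => H; move/negP: m0; apply; apply/cmP => i.
  by rewrite onecmE; apply: contrapT => /eqP mi; apply: H; exists i.
rewrite /monomial_eval (big_fsetD1 i) -?cmE_neq0 //=.
by rewrite expr0n (negbTE mi) mul0r mulr0.
Qed.

Lemma poly_nat_nonvanishing p : p != 0 ->
  exists v : I -> nat, poly_eval (fun i => (v i)%:R) p != 0.
Proof.
move=> p0.
have [m0 m0p] : exists m, m \in monalg.msupp p.
  by apply/fset0Pn; rewrite monalg.msupp_eq0.
have [|||||v hv] := @nat_nonvanishing _ R I (fun (m : cmonom I) i => m i)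
   (fun m => monalg.mcoeff m p) (monalg.msupp p) (variables p) m0.
- exact: fset_uniq.
- exact: fset_uniq.
- by [].
- by rewrite monalg.mcoeff_neq0.
- move=> m m' mp m'p e; apply/eqP/cmP => i.
  have [|iV] := boolP (i \in variables p); first exact: e.
  have out (k : cmonom I) : k \in monalg.msupp p -> k i = 0%N.
    move=> kp; apply/eqP; rewrite cmE_eq0; apply: contra iV.
    exact/fsubsetP/finsupp_variables.
  by rewrite !out.
by exists v; rewrite poly_evalE.
Qed.

End FreePolynomials.

(** * The free algebra generated by the family *)

Section FreeSubalgebra.
Variable R : realType.

Definition eval_hom (p : malg (cmonom (set R)) R) : (R * R)%type -> R :=
  fun z => poly_eval (fun A => (vfc_function A z)%:R) p.

Lemma eval_homP p : free_algebra p -> p != 0 ->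
  (VFC R `\` FC R) (eval_hom p) /\ exists z, eval_hom p z != 0.
Proof.
move=> pfree /poly_nat_nonvanishing[v pv].
apply: (@finitary_vfc_not_fc R (fun w => poly_eval w p) (variables p) v) => //.
- by move=> w w'; exact: poly_eval_local.
- exact: poly_eval0.
Qed.

Lemma free_algebra_subalgebra : [/\ @free_algebra R (set R) 0,
  forall p q, @free_algebra R (set R) p -> free_algebra q ->
    free_algebra (p + q),
  forall p q, @free_algebra R (set R) p -> free_algebra q ->
    free_algebra (p * q) &
  forall a p, @free_algebra R (set R) p -> free_algebra (a *: p)].
Proof.
rewrite /free_algebra /=; split=> [|p q p0 q0|p q p0 q0|a p p0].
- exact: monalg.mcoeff0.
- by rewrite monalg.mcoeffD p0 q0 addr0.
- have -> : monalg.mcoeff (onecm (set R)) (p * q) =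
      monalg.mcoeff (onecm (set R)) p * monalg.mcoeff (onecm (set R)) q.
    exact: rmorphM.
  by rewrite p0 mul0r.
- by rewrite monalg.mcoeffZ p0 mulr0.
Qed.

(** The algebra is the image of the polynomials without constant term. Its
    nonzero elements lie in the required set, and evaluation is injective since
    a nonzero polynomial gives a function that is nonzero somewhere. *)
Lemma strongly_algebrable_VFC_FC :
  @strongly_algebrable R ((R * R)%type -> R) (set R) [set: set R]
    (VFC R `\` FC R).
Proof.
have [free0 freeD freeM freeZ] := free_algebra_subalgebra.
have homD p q : eval_hom (p + q) = eval_hom p + eval_hom q.
  by apply/funext => z; exact: poly_evalD.
have homM p q : eval_hom (p * q) = eval_hom p * eval_hom q.
  by apply/funext => z; exact: poly_evalM.
have homZ a p : eval_hom (a *: p) = a *: eval_hom p.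
  by apply/funext => z; exact: poly_evalZ.
have hom0 : eval_hom 0 = 0.
  by apply/funext => z; exact: monalg.mmap0.
exists (set R : choiceType), (eval_hom @` @free_algebra R (set R)), eval_hom.
split; first exact: card_eqxx.
- split; first by exists 0.
  + by move=> _ _ [p pf <-] [q qf <-]; exists (p + q); [exact: freeD|].
  + by move=> _ _ [p pf <-] [q qf <-]; exists (p * q); [exact: freeM|].
  + by move=> a _ [p pf <-]; exists (a *: p); [exact: freeZ|].
- move=> _ [p pf <-]; have [->|p0] := eqVneq p 0; first by right.
  by left; case: (eval_homP pf p0).
- split=> //; split; [by move=> p pf; exists p| |by []].
  move=> p q; rewrite !inE => pf qf pq.
  apply: contrapT => /eqP; rewrite -subr_eq0 => pq0.
  have pqf : free_algebra (p - q) by rewrite -scaleN1r; apply/freeD/freeZ.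
  have [_ [z]] := eval_homP pqf pq0.
  by rewrite homD -scaleN1r homZ pq scaleN1r subrr eqxx.
Qed.

End FreeSubalgebra.

Theorem theorem17 (R : realType) :
  (exists F : set (R * R -> R),
     F #= [set: set R] /\
     forall (n : nat) (h : mpoly.mpoly n R),
       h != 0 -> mpoly.mcoeff mpoly.mnm0 h = 0 ->
       forall f : 'I_n -> (R * R -> R),
         injective f -> (forall i, F (f i)) ->
         (VFC R `\` FC R) (fun z => mpoly.meval (fun i => f i z) h)) /\
  @strongly_algebrable R ((R * R)%type -> R) (set R) [set: set R]
    (VFC R `\` FC R).
Proof.
split; last exact: strongly_algebrable_VFC_FC.
exists (range (fun A z => (vfc_function A z)%:R : R)); split.
  by apply: inj_card_eq => A B _ _; exact: vfc_function_inj.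
move=> n h h0 hc f f_inj fF.
have /boolp.choice[S fS] : forall i, exists A,
    f i = fun z => (vfc_function A z)%:R.
  by move=> i; have [A _ <-] := fF i; exists A.
have S_inj : injective S by move=> i j eS; apply: f_inj; rewrite !fS eS.
have [v hv] := mpoly_nat_nonvanishing h0.
(* transport the vector v along the indexing of the f i by distinct sets *)
pose v' A := if [pick i | S i == A] is Some i then v i else 0%N.
have v'S i : v' (S i) = v i.
  rewrite /v'; case: pickP => [j /eqP/S_inj-> //|/(_ i)]; by rewrite eqxx.
have [] := @finitary_vfc_not_fc R (fun w => mpoly.meval (fun i => w (S i)) h)
  [seq S i | i <- enum 'I_n] v'.
- move=> w w' ww'; apply: mpoly.meval_eq => i; apply: ww'.
  by rewrite map_f // mem_enum.
- exact: meval_zero.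
- by rewrite (mpoly.meval_eq (v2 := fun i => (v i)%:R)) // => i; rewrite v'S.
move=> + _; congr ((_ `\` _) _); apply/funext => z.
by apply: mpoly.meval_eq => i; rewrite fS.
Qed.
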